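(* Let $\mathcal{K}$ be a finite dimensional Hilbert space, $K$ a self-adjoint operator on $\mathcal{K}$ and $\beta>0$. Let $M$ be the generator of a $K$-invariant purely dissipative Markov completely positive semigroup on $B(\mathcal{K})$ satisfying the Detailed Balance Condition for $\mathrm{e}^{-\beta K}/\mathrm{Tr}\,\mathrm{e}^{-\beta K}$. Let the Hilbert space $\mathfrak{h}$ and $\nu\in B(\mathcal{K},\mathcal{K}\otimes\mathfrak{h})$ realize a minimal Lindblad form of $M$, i.e. $$M(A)=-\tfrac12\,[\nu^*\nu,A]_+ +\nu^*\,(A\otimes 1)\,\nu,\qquad A\in B(\mathcal{K}),$$ and $$\mathrm{span}\{((\phi|\otimes 1_{\mathfrak{h}})\,\nu\,\psi\ :\ \phi,\psi\in\mathcal{K}\}=\mathfrak{h}.$$ Let $Y$ be a self-adjoint operator on $\mathfrak{h}$ satisfying $$\nu K=(K\otimes1+1\otimes Y)\,\nu .$$ Then $$\mathrm{Tr}_{\mathfrak{h}}\,(\nu A\nu^* )=\nu^*\,(A\otimes\mathrm{e}^{-\beta Y})\,\nu\qquad\text{for all }A\in B(\mathcal{K}),$$ and there exists a unique antiunitary operator $\epsilon$ on $\mathfrak{h}$ such that $$(\phi\otimes w\,|\,\nu\psi)=(\nu\phi\,|\,\psi\otimes\mathrm{e}^{-\beta Y/2}\epsilon w),\qquad \phi,\psi\in\mathcal{K},\ w\in\mathfrak{h}.$$ Moreover, $\epsilon Y\epsilon=-Y$ and $\epsilon^2=1$.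
   Context: Scalar products are antilinear in the first argument. $[A,B]_+:=AB+BA$. For $\phi\in\mathcal{K}$, $(\phi|$ denotes the functional $f\mapsto(\phi|f)$, so $(\phi|\otimes1_{\mathfrak{h}}:\mathcal{K}\otimes\mathfrak{h}\to\mathfrak{h}$. $\mathrm{Tr}_{\mathfrak{h}}$ is the partial trace over $\mathfrak{h}$, mapping operators on $\mathcal{K}\otimes\mathfrak{h}$ to operators on $\mathcal{K}$. An antiunitary operator is an antilinear bijection with $(\epsilon u|\epsilon w)=(w|u)$. A semigroup $\mathrm{e}^{tM}$, $t\ge0$, on $B(\mathcal{K})$ is completely positive (c.p.) if each $\mathrm{e}^{tM}$ is completely positive; it is Markov if $\mathrm{e}^{tM}(1)=1$ for all $t\ge0$. Every generator $M$ of a c.p. semigroup on $B(\mathcal{K})$ can be written as $$M(A)=\mathrm{i}[\Theta,A]-[\Delta,A]_+ +\mu^*(A\otimes1)\mu,$$ with $\Theta,\Delta$ self-adjoint on $\mathcal{K}$, $\mu\in B(\mathcal{K},\mathcal{K}\otimes\mathfrak{g})$ for some Hilbert space $\mathfrak{g}$, where $\mathrm{Tr}\,\Theta=0$ and $\mathrm{Tr}\,\mu=0$ (the trace of $\mu$ is taken over $\mathcal{K}$, giving a vector in $\mathfrak{g}$). With these normalizations $\Theta$ and $\Delta$ are uniquely determined by $M$. One writes $M=\mathrm{i}[\Theta,\cdot]+M_{\mathrm d}$ for this canonical $\Theta$; $M_{\mathrm d}$ is called the purely dissipative part of $M$, and $M$ (or $\mathrm{e}^{tM}$) is called purely dissipative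 if $\Theta=0$. $M$ is $K$-invariant if $M(A)=\mathrm{e}^{-\mathrm{i}tK}M(\mathrm{e}^{\mathrm{i}tK}A\mathrm{e}^{-\mathrm{i}tK})\mathrm{e}^{\mathrm{i}tK}$ for all $t\in\mathbb{R}$ and $A\in B(\mathcal{K})$. For a nondegenerate (i.e. strictly positive) density matrix $\rho$ on $\mathcal{K}$, define the scalar product $(A|B)_\rho:=\mathrm{Tr}\,\rho^{1/2}A^*\rho^{1/2}B$ on $B(\mathcal{K})$. $M$ satisfies the Detailed Balance Condition for $\rho$ if $M_{\mathrm d}$ is self-adjoint and $\mathrm{i}[\Theta,\cdot]$ is anti-self-adjoint with respect to $(\cdot|\cdot)_\rho$. *)

(* Defs.v *)
From HB Require Import structures.
From mathcomp Require Import all_boot all_order all_algebra.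
From mathcomp Require Export complex mxtens.
From mathcomp Require Import all_classical all_reals all_analysis.

Set Implicit Arguments.
Unset Strict Implicit.
Unset Printing Implicit Defensive.

Import Order.TTheory GRing.Theory Num.Theory.
Import numFieldNormedType.Exports.

Local Open Scope classical_set_scope.
Local Open Scope ring_scope.
Local Open Scope sesquilinear_scope.

(* Finite dimensional Hilbert spaces are the column spaces 'cV[C]_n with
   C = R[i], operators are matrices acting on the left, and tensor products
   are Kronecker products: C^n (x) C^m is 'cV_(n * m), with coordinates indexed
   by mxtens_index (i, k). *)

Section Defs.
Variable R : realType.
Local Notation C := R[i].

(* Antilinear in the first argument. *)
Definition sprod n (x y : 'cV[C]_n) : C := (x ^t* *m y) 0 0.

Definition tensv n m (x : 'cV[C]_n) (w : 'cV[C]_m) : 'cV[C]_(n * m) := x *t w.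

(* (phi| (x) 1 : C^n (x) C^m -> C^m; the cast identifies C (x) C^m with C^m. *)
Definition bra_tens n m (phi : 'cV[C]_n) : 'M[C]_(m, n * m) :=
  castmx (mul1n m, erefl) (phi ^t* *t (1%:M : 'M[C]_m)).

Definition ptrace n m (X : 'M[C]_(n * m)) : 'M[C]_n :=
  \matrix_(i, j) \sum_(k < m) X (mxtens_index (i, k)) (mxtens_index (j, k)).

(* The trace over C^n of mu : C^n -> C^n (x) C^p, a vector of C^p. *)
Definition vtrace n p (mu : 'M[C]_(n * p, n)) : 'cV[C]_p :=
  \col_k \sum_(i < n) mu (mxtens_index (i, k)) i.

Definition anticomm n (A B : 'M[C]_n) : 'M[C]_n := A *m B + B *m A.

Definition comm n (A B : 'M[C]_n) : 'M[C]_n := A *m B - B *m A.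

(* Positivity of the number in the ordered field C includes its being real, so
   psdmx A implies that A is self-adjoint. *)
Definition psdmx n (A : 'M[C]_n) : Prop :=
  forall x : 'cV[C]_n, 0 <= sprod x (A *m x).

(* Square root of a positive semidefinite matrix by spectral calculus. *)
Definition sqrtmx n (A : 'M[C]_n) : 'M[C]_n :=
  invmx (spectralmx A) *m diag_mx (map_mx sqrtC (spectral_diag A))
    *m spectralmx A.

(* Exponential series, summed entrywise; C^o carries the topology of the
   modulus. *)
Definition expmx n (A : 'M[C]_n) : 'M[C]_n :=
  \matrix_(i, j) lim (series (fun k : nat => (A ^+ k) i j / k`!%:R : C^o) @ \oo).

(* e^L applied to A, for a superoperator L. *)
Definition expsop n (L : 'M[C]_n -> 'M[C]_n) (A : 'M[C]_n) : 'M[C]_n :=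
  \matrix_(i, j) lim (series (fun k : nat => (iter k L A) i j / k`!%:R : C^o) @ \oo).

(* The action F (x) id on 'M_(n * p) = 'M_n (x) 'M_p: F is applied to the
   (k, l) block of X, for k, l < p. *)
Definition amplify n (F : 'M[C]_n -> 'M[C]_n) p (X : 'M[C]_(n * p)) :
    'M[C]_(n * p) :=
  \matrix_(a, b)
    let: (i, k) := mxtens_unindex a in
    let: (j, l) := mxtens_unindex b in
    F (\matrix_(i', j') X (mxtens_index (i', k)) (mxtens_index (j', l))) i j.

Definition completely_positive n (F : 'M[C]_n -> 'M[C]_n) : Prop :=
  forall p (X : 'M[C]_(n * p)), psdmx X -> psdmx (amplify F X).

Definition semigroup n (M : 'M[C]_n -> 'M[C]_n) (t : R) : 'M[C]_n -> 'M[C]_n :=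
  expsop (fun A => t%:C%C *: M A).

Definition cp_generator n (M : 'M[C]_n -> 'M[C]_n) : Prop :=
  forall t : R, 0 <= t -> completely_positive (semigroup M t).

Definition markov_generator n (M : 'M[C]_n -> 'M[C]_n) : Prop :=
  forall t : R, 0 <= t -> semigroup M t 1%:M = 1%:M.

(* The normalizations Tr Theta = 0 and Tr mu = 0 determine Theta from M.  The
   auxiliary Hilbert space may be taken to be C^p, since the range of mu is
   contained in C^n (x) g' for some finite dimensional subspace g'. *)
Definition hamiltonian_part n (M : 'M[C]_n -> 'M[C]_n) (Theta : 'M[C]_n) :
    Prop :=
  exists p (Delta : 'M[C]_n) (mu : 'M[C]_(n * p, n)),
    [/\ Theta \is hermsymmx /\ \tr Theta = 0,
        Delta \is hermsymmx,
        vtrace mu = 0 &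
        forall A, M A = 'i *: comm Theta A - anticomm Delta A
                        + mu ^t* *m (A *t (1%:M : 'M[C]_p)) *m mu].

Definition purely_dissipative n (M : 'M[C]_n -> 'M[C]_n) : Prop :=
  hamiltonian_part M 0.

Definition invariant_under n (K : 'M[C]_n) (M : 'M[C]_n -> 'M[C]_n) : Prop :=
  forall (t : R) (A : 'M[C]_n),
    let U := expmx (('i * t%:C%C) *: K) in
    let V := expmx (- ('i * t%:C%C) *: K) in
    M A = V *m M (U *m A *m V) *m U.

Definition sprod_rho n (rho A B : 'M[C]_n) : C :=
  \tr (sqrtmx rho *m A ^t* *m sqrtmx rho *m B).

(* Meant for rho positive definite of trace 1. *)
Definition detailed_balance n (rho : 'M[C]_n) (M : 'M[C]_n -> 'M[C]_n) : Prop :=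
  exists Theta : 'M[C]_n,
    let H := fun A => 'i *: comm Theta A in
    let Md := fun A => M A - H A in
    [/\ hamiltonian_part M Theta,
        forall A B, sprod_rho rho (Md A) B = sprod_rho rho A (Md B) &
        forall A B, sprod_rho rho (H A) B = - sprod_rho rho A (H B)].

Definition gibbs n (beta : R) (K : 'M[C]_n) : 'M[C]_n :=
  let E := expmx (- beta%:C%C *: K) in (\tr E)^-1 *: E.

Definition lindblad_form n m (M : 'M[C]_n -> 'M[C]_n) (nu : 'M[C]_(n * m, n)) :
    Prop :=
  forall A, M A = - (2%:R^-1 *: anticomm (nu ^t* *m nu) A)
                  + nu ^t* *m (A *t (1%:M : 'M[C]_m)) *m nu.

Definition lindblad_minimal n m (nu : 'M[C]_(n * m, n)) : Prop :=
  forall w : 'cV[C]_m, exists r (c : 'I_r -> C) (phi psi : 'I_r -> 'cV[C]_n),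
    w = \sum_(k < r) c k *: (bra_tens m (phi k) *m nu *m psi k).

Definition antiunitary m (eps : 'cV[C]_m -> 'cV[C]_m) : Prop :=
  [/\ forall (a : C) u w, eps (a *: u + w) = a^* *: eps u + eps w,
      bijective eps &
      forall u w, sprod (eps u) (eps w) = sprod w u].

End Defs.

(* Main.v *)
Require Import Defs.
From HB Require Import structures.
From mathcomp Require Import all_boot all_order all_algebra.
From mathcomp Require Import complex mxtens ring.
From mathcomp Require Import all_classical all_reals all_analysis.
Import Order.TTheory GRing.Theory Num.Theory.
Import numFieldNormedType.Exports.
Local Open Scope ring_scope.
Local Open Scope sesquilinear_scope.

(** Write [V(w) = (1 (x) (w|) nu], [E = e^(-beta K/2)] and [F = e^(-beta Y/2)].
    The Hamiltonian part of a generator is determined by it, so here [M] itself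
    is self-adjoint for the scalar product of the Gibbs state.  The relation
    [nu K = (K (x) 1 + 1 (x) Y) nu] gives [nu E = (E (x) F) nu], hence
    [nu^* nu] commutes with [E]; in the self-adjointness of [M] the
    anticommutator terms then cancel, leaving
    [E nu^*(A (x) 1) nu E = Tr_h (nu E A E nu^* )], which is the first claim.
    This claim says that the operators [V(w)^*] and [V(F w)] give two Kraus
    decompositions of the same map; by minimality the latter is linearly
    independent, so they differ by a unitary, i.e. [V(w)^* = V(F eps w)] for an
    antiunitary [eps].  Finally [V(w) E = E V(F w)] gives [F eps F = eps], and
    [V(w) K - K V(w) = V(Y w)] gives [eps Y = - Y eps]; taking adjoints twice,
    [V(w) = V(F eps F eps w) = V(eps (eps w))], so [eps^2 = 1]. *)

(** * Functional calculus of normal matrices and intertwining relations *)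

Section SpectralCalculus.
Set Implicit Arguments.
Unset Strict Implicit.
Variable C : numClosedFieldType.

(** Entrywise, [X i j * a_j = b_i * X i j]: either the entry vanishes or the two eigenvalues agree,
    and then so do their images under an arbitrary [f]. *)
Lemma diag_intertwine_map p q a b (X : 'M[C]_(q, p)) (f : C -> C) :
  X *m diag_mx a = diag_mx b *m X ->
  X *m diag_mx (map_mx f a) = diag_mx (map_mx f b) *m X.
Proof.
move=> /matrixP Xab; apply/matrixP => i j; have := Xab i j.
rewrite !mul_mx_diag !mul_diag_mx !mxE ![X i j * _]mulrC.
by have [->|X0 /(mulIf X0) ->] := eqVneq (X i j) 0; rewrite ?mulr0.
Qed.

(** Any diagonalizations are allowed, not only those chosen by [spectralmx]; this permits product
    bases on a tensor product. *)
Lemma diag_intertwine p q (P P' : 'M[C]_p) (Q Q' : 'M[C]_q) a b (X : 'M[C]_(q, p))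
    (f : C -> C) :
  P' *m P = 1%:M -> Q' *m Q = 1%:M ->
  X *m (P' *m diag_mx a *m P) = Q' *m diag_mx b *m Q *m X ->
  X *m (P' *m diag_mx (map_mx f a) *m P) = Q' *m diag_mx (map_mx f b) *m Q *m X.
Proof.
move=> P'P Q'Q XA; have PP' := mulmx1C P'P; have QQ' := mulmx1C Q'Q.
pose Z := Q *m X *m P'.
have Zab : Z *m diag_mx a = diag_mx b *m Z.
  have := congr1 (fun W => Q *m W *m P') XA.
  rewrite /Z !mulmxA QQ' mul1mx => <-.
  by rewrite -!mulmxA PP' mulmx1.
have Zf := diag_intertwine_map f Zab.
have -> : X *m (P' *m diag_mx (map_mx f a) *m P) = Q' *m (Z *m diag_mx (map_mx f a)) *m P.
  by rewrite /Z !mulmxA Q'Q mul1mx.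
by rewrite Zf /Z -!mulmxA P'P mulmx1.
Qed.

(** Same shape as [sqrtmx], which is [spectral_fun sqrtC] by conversion. *)
Definition spectral_fun n (f : C -> C) (A : 'M[C]_n) : 'M[C]_n :=
  invmx (spectralmx A) *m diag_mx (map_mx f (spectral_diag A)) *m spectralmx A.

Lemma spectral_fun_id n (A : 'M[C]_n) : A \is normalmx ->
  invmx (spectralmx A) *m diag_mx (spectral_diag A) *m spectralmx A = A.
Proof. by move=> /orthomx_spectralP. Qed.

Lemma spectral_fun_intertwine p q (A : 'M[C]_p) (B : 'M[C]_q) X f :
  A \is normalmx -> B \is normalmx -> X *m A = B *m X ->
  X *m spectral_fun f A = spectral_fun f B *m X.
Proof.
move=> hA hB XA; apply: diag_intertwine; rewrite ?mulVmx ?spectral_unit //.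
by rewrite !spectral_fun_id.
Qed.

(** Independence of the diagonalization: the identity intertwines the given one with the one chosen
    by [spectralmx]. *)
Lemma spectral_fun_diag n (A P P' : 'M[C]_n) d f :
  A \is normalmx -> P' *m P = 1%:M -> A = P' *m diag_mx d *m P ->
  spectral_fun f A = P' *m diag_mx (map_mx f d) *m P.
Proof.
move=> hA P'P Ad; rewrite -[LHS]mul1mx -[RHS]mulmx1.
apply: diag_intertwine => //; rewrite ?mulVmx ?spectral_unit //.
by rewrite mul1mx mulmx1 spectral_fun_id.
Qed.

Lemma spectral_fun_normal n f (A : 'M[C]_n) : spectral_fun f A \is normalmx.
Proof.
apply/orthomx_spectral_subproof.
by exists (spectralmx A, map_mx f (spectral_diag A)); rewrite //= spectral_unitarymx.
Qed.

(** [spectralmx] may pick another eigenbasis for [spectral_fun f A] than for [A], hence the appeal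
    to [spectral_fun_diag]. *)
Lemma spectral_fun_comp n f g (A : 'M[C]_n) :
  spectral_fun g (spectral_fun f A) = spectral_fun (g \o f) A.
Proof.
have AE := spectral_fun_diag g (spectral_fun_normal f A) (mulVmx (spectral_unit A)).
rewrite (AE _ (erefl _)).
by rewrite -map_mx_comp.
Qed.

Lemma spectral_fun_eq n f g (A : 'M[C]_n) : f =1 g -> spectral_fun f A = spectral_fun g A.
Proof. by move=> fg; rewrite /spectral_fun (eq_map_mx _ fg). Qed.

Lemma spectral_fun_mul n f g (A : 'M[C]_n) :
  spectral_fun f A *m spectral_fun g A = spectral_fun (fun x => f x * g x) A.
Proof.
have := mulmxV (spectral_unit A); rewrite /spectral_fun.
move: (spectralmx A) (spectral_diag A) (invmx _) => P d P' PP'.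
rewrite -!mulmxA (mulmxA P) PP' mul1mx (mulmxA (diag_mx _)) mulmx_diag.
by congr (_ *m (diag_mx _ *m _)); apply/rowP => i; rewrite !mxE.
Qed.

Lemma spectral_fun_scale n c f (A : 'M[C]_n) :
  c *: spectral_fun f A = spectral_fun (fun x => c * f x) A.
Proof.
rewrite /spectral_fun; move: (spectralmx A) (spectral_diag A) (invmx _) => P d P'.
rewrite scalemxAl scalemxAr; congr (_ *m _ *m _).
by apply/matrixP => i j; rewrite !mxE mulrnAr.
Qed.

Lemma spectral_fun_cst1 n (A : 'M[C]_n) : spectral_fun (fun=> 1) A = 1%:M.
Proof.
rewrite /spectral_fun (_ : map_mx _ _ = const_mx 1); last first.
  by apply/rowP => i; rewrite !mxE.
by rewrite diag_const_mx mulmx1 mulVmx ?spectral_unit.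
Qed.


Lemma spectral_fun_herm n f (A : 'M[C]_n) :
  (forall x, (f x)^* = f x) -> (spectral_fun f A)^t* = spectral_fun f A.
Proof.
move=> fr; rewrite /spectral_fun invmx_unitary ?spectral_unitarymx //.
rewrite !trmx_mul !map_mxM -mulmxA trmxCK; congr (_ *m (_ *m _)).
by apply/matrixP => i j; rewrite !mxE rmorphMn /= fr eq_sym; case: eqP => // ->.
Qed.

Lemma mxtrace_spectral_fun n f (A : 'M[C]_n) :
  \tr (spectral_fun f A) = \sum_i f (spectral_diag A 0 i).
Proof.
rewrite /spectral_fun mxtrace_mulC mulKVmx ?spectral_unit // mxtrace_diag.
by apply: eq_bigr => i _; rewrite !mxE.
Qed.

Lemma conj_diag_expr n (P P' : 'M[C]_n) d k : P' *m P = 1%:M ->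
  (P' *m diag_mx d *m P) ^+ k = P' *m diag_mx (map_mx (fun x => x ^+ k) d) *m P.
Proof.
move=> P'P; have PP' := mulmx1C P'P.
elim: k => [|k IH].
  rewrite expr0 (_ : map_mx _ d = const_mx 1); last by apply/rowP=> i; rewrite !mxE.
  by rewrite diag_const_mx mulmx1 P'P.
rewrite exprS IH -[LHS]/(_ *m _) !mulmxA -(mulmxA _ P P') PP' mulmx1.
congr (_ *m _); rewrite -mulmxA mulmx_diag; congr (_ *m diag_mx _).
by apply/rowP=> i; rewrite !mxE exprS.
Qed.

Lemma conj_diagE n (P P' : 'M[C]_n) d i j :
  (P' *m diag_mx d *m P) i j = \sum_l (P' i l * P l j) * d 0 l.
Proof.
by rewrite mul_mx_diag !mxE; apply: eq_bigr => l _; rewrite !mxE mulrAC.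
Qed.

(** [K (x) 1 + 1 (x) Y] is diagonal in the product of the two eigenbases, with eigenvalues
    [a_i + b_k]. Since [f] turns sums into products, applying it to these gives
    [spectral_fun f K *t spectral_fun f Y]. *)
Lemma spectral_fun_tens_intertwine n m (nu : 'M[C]_(n * m, n)) (K : 'M[C]_n) (Y : 'M[C]_m)
    (f : C -> C) :
  K \is normalmx -> Y \is normalmx -> (forall x y, f (x + y) = f x * f y) ->
  nu *m K = (K *t 1%:M + 1%:M *t Y) *m nu ->
  nu *m spectral_fun f K = (spectral_fun f K *t spectral_fun f Y) *m nu.
Proof.
move=> nK nY fD nuK; move: (spectral_fun_id nK) (spectral_fun_id nY).
have := mulVmx (spectral_unit K); have := mulVmx (spectral_unit Y); rewrite /spectral_fun.
move: (spectralmx K) (spectral_diag K) (invmx (spectralmx K)) => P a P'.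
move: (spectralmx Y) (spectral_diag Y) (invmx (spectralmx Y)) => Q b Q' Q'Q P'P KE YE.
pose d := \row_s (a 0 (mxtens_unindex s).1 + b 0 (mxtens_unindex s).2).
have PQ : (P' *t Q') *m (P *t Q) = 1%:M.
  apply/matrixP => s t; rewrite tensmx_mul P'P Q'Q.
  case: (mxtens_indexP s) => i k; case: (mxtens_indexP t) => j l.
  by rewrite tensmxE !mxE -natrM mulnb (can_eq (@mxtens_indexK n m)).
have dE : (P' *t Q') *m diag_mx d *m (P *t Q) = K *t 1%:M + 1%:M *t Y.
  have -> : diag_mx d = diag_mx a *t 1%:M + 1%:M *t diag_mx b.
    apply/matrixP => s t.
    case: (mxtens_indexP s) => i k; case: (mxtens_indexP t) => j l.
    rewrite [RHS]mxE !tensmxE !mxE (can_eq (@mxtens_indexK n m)) !mxtens_indexK /=.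
    rewrite -pair_eqE /=; case: eqP; case: eqP => /= _ _;
      by rewrite ?mulr0n ?mulr1n ?mulr0 ?mul0r ?mulr1 ?mul1r ?addr0.
  by rewrite mulmxDr mulmxDl !tensmx_mul !mulmx1 P'P Q'Q KE YE.
have -> : (P' *m diag_mx (map_mx f a) *m P) *t (Q' *m diag_mx (map_mx f b) *m Q)
    = (P' *t Q') *m diag_mx (map_mx f d) *m (P *t Q).
  rewrite -!tensmx_mul; congr (_ *m _ *m _); apply/matrixP => s t.
  case: (mxtens_indexP s) => i k; case: (mxtens_indexP t) => j l.
  rewrite tensmxE !mxE (can_eq (@mxtens_indexK n m)) !mxtens_indexK /= fD.
  rewrite -pair_eqE /=; case: eqP; case: eqP => /= _ _;
    by rewrite ?mulr0n ?mulr1n ?mulr0 ?mul0r.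
by apply: diag_intertwine; rewrite // dE KE.
Qed.

Lemma hermsymmx_adj n (A : 'M[C]_n) : A \is hermsymmx -> A^t* = A.
Proof. by move=> /is_hermitianmxP; rewrite expr0 scale1r => {2}->. Qed.

End SpectralCalculus.

(** * The exponential series of a self-adjoint matrix *)

Section Expmx.
Set Implicit Arguments.
Unset Strict Implicit.
Variable R : realType.
Local Notation C := R[i].

Lemma cvg_sum_seq (K : numFieldType) (V : normedModType K) I (r : seq I)
    (f : I -> nat -> V) (a : I -> V) :
  (forall i, (f i @ \oo --> a i)%classic) ->
  ((fun k => \sum_(i <- r) f i k) @ \oo --> \sum_(i <- r) a i)%classic.
Proof. 
move=> fa; elim: r => [|i r IH].
  by under eq_fun do rewrite big_nil; rewrite big_nil; exact: cvg_cst.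
by under eq_fun do rewrite big_cons; rewrite big_cons; exact: cvgD.
Qed.

Lemma cvg_real_complex (u : nat -> R) (l : R) :
  (u @ \oo --> l)%classic ->
  ((fun k => (u k)%:C%C : C^o) @ \oo --> (l%:C%C : C^o))%classic.
Proof.
move=> /cvgrPdist_lt ul; apply/cvgrPdist_lt => e e0.
(* A positive element of [C] is real. *)
have e_re : e = (complex.Re e)%:C%C.
  by case: e e0 => a b; rewrite ltcE /= => /andP[/eqP -> _].
move: e0; rewrite e_re ltcR => e0.
near=> k.
rewrite -rmorphB /= normc_def /= expr0n addr0 sqrtr_sqr ltcR.
near: k; exact: ul.
Unshelve. all: by end_near.
Qed.

(** Agrees with exp(tz) for real [z], the case of eigenvalues of self-adjoint matrices. Taking the
    real part keeps it real and positive on all of [C], where it still turns sums into products. *)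
Definition cexp (t : R) (z : C) : C := (expR (t * complex.Re z))%:C%C.

Lemma expmx_diag n (P P' : 'M[C]_n) (d : 'rV[R]_n) : P' *m P = 1%:M ->
  expmx (P' *m diag_mx (map_mx (fun x => x%:C%C) d) *m P) =
  P' *m diag_mx (map_mx (fun x => (expR x)%:C%C) d) *m P.
Proof.
move=> P'P; set D := map_mx _ d.
apply/matrixP => i j; rewrite mxE conj_diagE.
apply: (@cvg_lim (C^o : normedModType C)); first exact: norm_hausdorff.
(* Each entry of a partial sum of the matrix series is a finite combination of partial sums of real
   exponential series. *)
have H : ((fun N => \sum_l (P' i l * P l j) *
      (series (exp_coeff (d 0 l)) N)%:C%C : C^o) @ \oo -->
    (\sum_l (P' i l * P l j) * (expR (d 0 l))%:C%C : C^o))%classic.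
  apply: (@cvg_sum_seq _ C^o) => l.
  apply: cvgMr; apply: cvg_real_complex.
  by rewrite /expR; exact: is_cvg_series_exp_coeff.
rewrite (eq_bigr (fun l => P' i l * P l j * (expR (d 0 l))%:C%C)); last first.
  by move=> l _; rewrite mxE.
apply: cvg_trans H; apply: near_eq_cvg; near=> N; rewrite /series /=; symmetry.
under [RHS]eq_bigr do rewrite rmorph_sum big_distrr /=.
rewrite exchange_big /=; apply: eq_bigr => k _.
rewrite conj_diag_expr // conj_diagE mulr_suml; apply: eq_bigr => l _.
by rewrite !mxE /exp_coeff /= rmorphM rmorphXn /= fmorphV /= rmorph_nat mulrA.
Unshelve. all: by end_near.
Qed.

Lemma expmx_spectral_fun n (t : R) (A : 'M[C]_n) : A \is hermsymmx ->
  expmx (t%:C%C *: A) = spectral_fun (cexp t) A.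
Proof.
move=> hA; have nA := hermitian_normalmx hA.
have /mxOverP re := hermitian_spectral_diag_real hA.
pose d : 'rV[R]_n := \row_i (t * complex.Re (spectral_diag A 0 i)).
rewrite -{1}(spectral_fun_id nA) scalemxAl scalemxAr.
have -> : t%:C%C *: diag_mx (spectral_diag A) = diag_mx (map_mx (fun x => x%:C%C) d).
  apply/matrixP => i j; rewrite !mxE mulrnAr rmorphM /=; congr (_ * _ *+ _).
  have := re 0 i; case: (spectral_diag A 0 i) => a b.
  by rewrite complex_real /= => /eqP ->.
have dE : map_mx (cexp t) (spectral_diag A) = map_mx (fun x => (expR x)%:C%C) d.
  by apply/rowP => i; rewrite !mxE.
rewrite /spectral_fun dE; exact: expmx_diag (mulVmx (spectral_unit A)).
Qed.

End Expmx.

(** * Kraus families, partial traces and trace pairings *)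

Section Kraus.
Set Implicit Arguments.
Unset Strict Implicit.
Variable C : numClosedFieldType.

Lemma big_mxtens (V : nmodType) n m (F : 'I_(n * m) -> V) :
  \sum_a F a = \sum_i \sum_k F (mxtens_index (i, k)).
Proof.
rewrite pair_big /= (reindex (@mxtens_index n m)) /=; last first.
  by exists (@mxtens_unindex n m) => x _; rewrite ?mxtens_indexK ?mxtens_unindexK.
by apply: eq_bigr => -[i k].
Qed.

Lemma adjmx_mul m n p (A : 'M[C]_(m, n)) (B : 'M[C]_(n, p)) :
  (A *m B)^t* = B^t* *m A^t*.
Proof. by rewrite trmx_mul map_mxM. Qed.

Lemma adjmx_tens m n p q (A : 'M[C]_(m, n)) (B : 'M[C]_(p, q)) :
  (A *t B)^t* = A^t* *t B^t*.
Proof. by rewrite trmx_tens map_mxT. Qed.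

Lemma adjmx1 n : (1%:M : 'M[C]_n)^t* = 1%:M.
Proof. by rewrite trmx1 map_mx1. Qed.

Lemma adjmx_delta m n (i : 'I_m) (j : 'I_n) :
  (delta_mx i j : 'M[C]_(m, n))^t* = delta_mx j i.
Proof. by rewrite trmx_delta map_delta_mx. Qed.

Lemma mul_delta_mxE m n p q (A : 'M[C]_(m, n)) (B : 'M[C]_(p, q)) i j k l :
  (A *m delta_mx j k *m B) i l = A i j * B k l.
Proof.
rewrite -mulmxA mxE (bigD1 j) //= mxE (bigD1 k) //= mxE !eqxx mul1r.
rewrite big1 ?addr0 => [|t /negPf tk]; last by rewrite mxE tk andbF mul0r.
rewrite big1 ?addr0 // => t /negPf tj; rewrite mxE big1 ?mulr0 // => s _.
by rewrite mxE tj mul0r.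
Qed.

Lemma mxtrace_mul_inj n (A B : 'M[C]_n) :
  (forall X, \tr (A *m X) = \tr (B *m X)) -> A = B.
Proof.
move=> AB; apply/matrixP => i j; have := AB (delta_mx j i).
have tr_delta (D : 'M[C]_n) : \tr (D *m delta_mx j i) = D i j.
  rewrite /mxtrace (bigD1 i) //= mxE (bigD1 j) //= mxE !eqxx mulr1.
  rewrite !big1 ?addr0 // => k /negPf ki; last by rewrite mxE ki mulr0.
  by rewrite mxE big1 // => l _; rewrite mxE ki andbF mulr0.
by rewrite !tr_delta.
Qed.

(** Removes the normalization of the square root of the Gibbs state, which enters twice on each side
    of detailed balance. *)
Lemma mxtrace_scale_inj n (c : C) (E A B A' B' : 'M[C]_n) : c != 0 ->
  \tr ((c *: E) *m A *m (c *: E) *m B) = \tr ((c *: E) *m A' *m (c *: E) *m B') ->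
  \tr (E *m A *m E *m B) = \tr (E *m A' *m E *m B').
Proof.
by move=> c0; rewrite -!(scalemxAl, scalemxAr) !mxtraceZ => /(mulfI c0) /(mulfI c0).
Qed.

Lemma adjmx_mul_eq0 m n (A : 'M[C]_(m, n)) : A^t* *m A = 0 -> A = 0.
Proof.
move=> AA0; apply/matrixP => i j; rewrite mxE.
have /eqP := congr1 (fun X : 'M[C]_n => X j j) AA0; rewrite !mxE psumr_eq0.
  move=> /allP /(_ i); rewrite mem_index_enum !mxE -normCKC sqrf_eq0 normr_eq0.
  by move=> /(_ isT)/eqP.
by move=> k _; rewrite !mxE -normCKC exprn_ge0.
Qed.

(** Equal Gram matrices make [A x] and [B x] equal in norm, so [A] kills what [B] kills, in
    particular [D *m B - 1] for a right inverse [D] of [B]. Hence [A] is [A *m D] times [B], and the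
    Gram matrix of [A *m D] is that of [B *m D = 1]. *)
Lemma gram_unitary m p (A B : 'M[C]_(m, p)) :
  row_free B -> A^t* *m A = B^t* *m B ->
  exists2 U : 'M[C]_m, U \is unitarymx & A = U *m B.
Proof.
move=> /row_freeP[D BD] AB; pose U := A *m D.
have AUB : A = U *m B.
  apply/esym/eqP; rewrite -subr_eq0; apply/eqP.
  have -> : U *m B - A = A *m (D *m B - 1%:M) by rewrite mulmxBr mulmx1 mulmxA.
  apply: adjmx_mul_eq0; rewrite adjmx_mul -mulmxA (mulmxA (A^t* )) AB -mulmxA.
  by rewrite mulmxBr mulmx1 (mulmxA B) BD mul1mx subrr !mulmx0.
exists U => //; apply/unitarymxP/mulmx1C.
have : (A *m D)^t* *m (A *m D) = (B *m D)^t* *m (B *m D).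
  by rewrite !adjmx_mul -!mulmxA (mulmxA (A^t* )) AB !mulmxA.
by rewrite BD adjmx1 mul1mx.
Qed.

(** * Duality of the partial trace and the detailed balance identity *)

Section PartialTrace.
Variables (n m : nat).
Implicit Types (nu : 'M[C]_(n * m, n)) (A B : 'M[C]_n).
Local Notation ptr X := (\matrix_(i, j) \sum_(k < m)
  X (mxtens_index (i, k)) (mxtens_index (j, k)) : 'M[C]_n).

(** Values on matrix units, the entries of the Choi matrix: two Kraus forms are compared through
    them. *)
Lemma kraus_form_delta (mu : 'M[C]_(n * m, n)) j l i i' :
  (mu^t* *m (delta_mx j l *t 1%:M) *m mu) i i' =
  \sum_k (mu (mxtens_index (j, k)) i)^* * mu (mxtens_index (l, k)) i'.
Proof.
have E p k : (delta_mx j l *t (1%:M : 'M[C]_m) *m mu) (mxtens_index (p, k)) i' =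
    (p == j)%:R * mu (mxtens_index (l, k)) i'.
  rewrite mxE big_mxtens (bigD1 l) //= (bigD1 k) //= tensmxE !mxE !eqxx mulr1 andbT.
  rewrite !big1 ?addr0 //.
    move=> q /negPf ql; rewrite big1 // => k' _.
    by rewrite tensmxE !mxE ql andbF !mul0r.
  by move=> k' /negPf kk'; rewrite tensmxE !mxE [k == _]eq_sym kk' mulr0 mul0r.
rewrite -mulmxA mxE big_mxtens (bigD1 j) //= [X in _ + X]big1 ?addr0.
  by apply: eq_bigr => k _; rewrite E eqxx mul1r !mxE.
by move=> p /negPf pj; rewrite big1 // => k _; rewrite E pj mul0r mulr0.
Qed.

Lemma kraus_form_adj (mu : 'M[C]_(n * m, n)) A :
  (mu^t* *m (A *t 1%:M) *m mu)^t* = mu^t* *m (A^t* *t 1%:M) *m mu.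
Proof. by rewrite adjmx_mul adjmx_mul adjmx_tens adjmx1 trmxCK mulmxA. Qed.

Lemma mxtrace_tens1_mul A (X : 'M[C]_(n * m)) :
  \tr ((A *t 1%:M) *m X) = \tr (A *m ptr X).
Proof.
rewrite /mxtrace big_mxtens; apply: eq_bigr => i _.
under eq_bigr do rewrite mxE big_mxtens.
rewrite exchange_big mxE; apply: eq_bigr => j _; rewrite mxE big_distrr /=.
apply: eq_bigr => k _; rewrite (bigD1 k) //= tensmxE mxE eqxx mulr1.
by rewrite big1 ?addr0 // => l /negPf lk; rewrite tensmxE mxE eq_sym lk mulr0 mul0r.
Qed.

(** Passage from the Heisenberg to the Schroedinger picture: the partial trace is dual to tensoring
    with the identity. *)
Lemma mxtrace_dual nu A B :
  \tr (nu^t* *m (A *t 1%:M) *m nu *m B) = \tr (A *m ptr (nu *m B *m nu^t* )).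
Proof.
by rewrite -mxtrace_tens1_mul -2!mulmxA mxtrace_mulC !mulmxA.
Qed.

(** [E] and [F] stand for the exponentials of [- beta K / 2] and [- beta Y / 2]; up to a scalar, [E]
    is the square root of the Gibbs state. *)
Lemma ptrace_of_detailed_balance nu (E Ei : 'M[C]_n) (F : 'M[C]_m) :
  E^t* = E -> F^t* = F -> E *m Ei = 1%:M ->
  nu *m E = (E *t F) *m nu ->
  let N := nu^t* *m nu in
  let L A := - (2%:R^-1 *: (N *m A + A *m N)) + nu^t* *m (A *t 1%:M) *m nu in
  (forall A B, \tr (E *m (L A)^t* *m E *m B) = \tr (E *m A^t* *m E *m L B)) ->
  forall A, ptr (nu *m A *m nu^t* ) = nu^t* *m (A *t (F *m F)) *m nu.
Proof.
move=> hE hF EEi nuE N L db' A; have EiE := mulmx1C EEi.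
have Enu : E *m nu^t* = nu^t* *m (E *t F).
  by rewrite -{1}hE -adjmx_mul nuE adjmx_mul adjmx_tens hE hF.
(* Both sides equal [nu^t* *m (E *t F) *m nu]. *)
have NE : N *m E = E *m N by rewrite /N mulmxA Enu -!mulmxA nuE.
have L_adj A' : (L A')^t* = L (A'^t* ).
  rewrite /L; have : N^t* = N by rewrite /N adjmx_mul trmxCK.
  clearbody N => hN.
  rewrite linearD /= map_mxD kraus_form_adj linearN linearZ /= map_mxN map_mxZ.
  rewrite linearD /= map_mxD !adjmx_mul hN.
  by rewrite fmorphV rmorph_nat [_ *m N + _]addrC.
(* As [L] commutes with taking adjoints, replacing [A'] by its adjoint removes the adjoint from the
   scalar product. *)
have db A' B' : \tr (E *m L A' *m E *m B') = \tr (E *m A' *m E *m L B').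
  by have := db' (A'^t* ) B'; rewrite L_adj trmxCK.
have kraus_db A' B' : \tr (E *m (nu^t* *m (A' *t 1%:M) *m nu) *m E *m B') =
    \tr (E *m A' *m E *m (nu^t* *m (B' *t 1%:M) *m nu)).
  have := db A' B'; rewrite /L !mulmxDr !mulmxDl !mxtraceD.
  (* The anticommutator terms agree in crosswise pairs: [N] moves past [E], and in one pair also
     around the trace. *)
  suff -> : \tr (E *m - (2^-1 *: (N *m A' + A' *m N)) *m E *m B') =
            \tr (E *m A' *m E *m - (2^-1 *: (N *m B' + B' *m N))) by move=> /addrI.
  clearbody N; rewrite !mulmxN !mulNmx -!scalemxAr -!scalemxAl !mulmxDr !mulmxDl.
  rewrite !raddfN /= !mxtraceZ !mxtraceD addrC; congr (- (_ * (_ + _))).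
    by rewrite !mulmxA -(mulmxA _ N E) NE !mulmxA.
  by rewrite [in RHS]mulmxA [RHS]mxtrace_mulC !mulmxA NE.
(* Self-adjointness moves the map onto the test matrix [X], and [mxtrace_dual] moves it back as a
   partial trace. *)
have EPE A' : E *m (nu^t* *m (A' *t 1%:M) *m nu) *m E =
    ptr (nu *m (E *m A' *m E) *m nu^t* ).
  apply: mxtrace_mul_inj => X; rewrite kraus_db mxtrace_mulC mxtrace_dual.
  by rewrite mxtrace_mulC.
(* Evaluating at [Ei *m A *m Ei] undoes the conjugation by [E]; on the Kraus side the two factors
   [E *t F] leave [F *m F] behind. *)
have := EPE (Ei *m A *m Ei).
have -> : E *m (Ei *m A *m Ei) *m E = A by rewrite !mulmxA EEi mul1mx -mulmxA EiE mulmx1.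
move=> <-.
rewrite !mulmxA Enu -(mulmxA _ nu E) nuE !mulmxA; congr (_ *m nu).
rewrite -!mulmxA !tensmx_mul mul1mx; congr (_ *m (_ *t _)).
by rewrite -!mulmxA EiE mulmx1 mulmxA EEi mul1mx.
Qed.

End PartialTrace.

(** * The operators [V(w)] *)

Section Components.
Variables (n m : nat).
Implicit Types (nu : 'M[C]_(n * m, n)) (u w : 'cV[C]_m).

(* [(1 (x) (w|) nu] as an operator on C^n, hence antilinear in [w]. *)
Definition kraus nu w : 'M[C]_n :=
  \matrix_(i, j) \sum_k (w k 0)^* * nu (mxtens_index (i, k)) j.

(** With [kraus_adj_tensv] and [form_inj], this turns the relation defining [eps] into an identity
    between operators. *)
Lemma kraus_tensv nu w (phi psi : 'cV[C]_n) :
  ((phi *t w)^t* *m (nu *m psi)) 0 0 = (phi^t* *m kraus nu w *m psi) 0 0.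
Proof.
rewrite -[in RHS]mulmxA [LHS]mxE [RHS]mxE big_mxtens; apply: eq_bigr => i _.
have entry k : (phi *t w)^t* 0 (mxtens_index (i, k)) = (phi i 0)^* * (w k 0)^*.
  by rewrite !mxE mxtens_indexK /= !ord1 rmorphM.
have braE : (phi^t* ) 0 i = (phi i 0)^* by rewrite !mxE.
have ketE k : (nu *m psi) (mxtens_index (i, k)) 0 =
  \sum_j nu (mxtens_index (i, k)) j * psi j 0 by rewrite mxE.
have opE : (kraus nu w *m psi) i 0 =
  \sum_j (\sum_k (w k 0)^* * nu (mxtens_index (i, k)) j) * psi j 0.
  by rewrite mxE; apply: eq_bigr => j _; rewrite mxE.
rewrite braE opE big_distrr /=.
under eq_bigr do rewrite entry ketE big_distrr /=.
under [RHS]eq_bigr do rewrite big_distrl big_distrr /=.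
rewrite exchange_big /=; apply: eq_bigr => j _; apply: eq_bigr => k _.
by rewrite !mulrA.
Qed.

Lemma kraus_adj_tensv nu u (phi psi : 'cV[C]_n) :
  ((nu *m phi)^t* *m (psi *t u)) 0 0 = (phi^t* *m (kraus nu u)^t* *m psi) 0 0.
Proof.
have adj00 (X : 'M[C]_1) : (X^t* ) 0 0 = (X 0 0)^* by rewrite !mxE.
have -> : (nu *m phi)^t* *m (psi *t u) = ((psi *t u)^t* *m (nu *m phi))^t*.
  by rewrite [RHS]adjmx_mul trmxCK.
have -> : phi^t* *m (kraus nu u)^t* *m psi = (psi^t* *m kraus nu u *m phi)^t*.
  by rewrite [RHS]adjmx_mul [in RHS]adjmx_mul trmxCK mulmxA.
by rewrite !adj00 kraus_tensv.
Qed.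

Lemma form_inj (A B : 'M[C]_n) :
  (forall phi psi : 'cV[C]_n, (phi^t* *m A *m psi) 0 0 = (phi^t* *m B *m psi) 0 0) ->
  A = B.
Proof.
move=> AB; apply/matrixP => i j; have := AB (delta_mx i 0) (delta_mx j 0).
by rewrite !adjmx_delta -!rowE -!colE !mxE.
Qed.

Lemma kraus_mulr nu w A : kraus (nu *m A) w = kraus nu w *m A.
Proof.
apply/matrixP => i j; rewrite !mxE.
under eq_bigr do rewrite mxE big_distrr /=.
rewrite exchange_big /=; apply: eq_bigr => k _; rewrite mxE big_distrl /=.
by apply: eq_bigr => l _; rewrite mulrA.
Qed.

Lemma kraus_tensl nu w (A : 'M[C]_n) (B : 'M[C]_m) :
  kraus ((A *t B) *m nu) w = A *m kraus nu (B^t* *m w).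
Proof.
apply/matrixP => i j; rewrite !mxE.
under eq_bigr do rewrite mxE big_mxtens big_distrr /=.
rewrite exchange_big /=; apply: eq_bigr => p _; rewrite mxE big_distrr /=.
under eq_bigr do rewrite big_distrr /=.
rewrite exchange_big /=; apply: eq_bigr => l _.
rewrite mxE rmorph_sum big_distrl big_distrr /=; apply: eq_bigr => k _.
have -> : (B^t* ) l k = (B k l)^* by rewrite !mxE.
by rewrite tensmxE rmorphM /= conjCK -!mulrA mulrCA [X in _ * X]mulrCA.
Qed.

Lemma krausD mu nu w : kraus (mu + nu) w = kraus mu w + kraus nu w.
Proof.
apply/matrixP => i j; rewrite !mxE -big_split /=; apply: eq_bigr => k _.
by rewrite mxE mulrDr.
Qed.

Lemma kraus_antilinear nu (a : C) u w :
  kraus nu (a *: u + w) = a^* *: kraus nu u + kraus nu w.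
Proof.
apply/matrixP => i j; rewrite !mxE big_distrr -big_split /=; apply: eq_bigr => k _.
by rewrite !mxE rmorphD rmorphM /= mulrDl mulrA.
Qed.

Lemma kraus_commutator nu (K : 'M[C]_n) (Y : 'M[C]_m) w : Y^t* = Y ->
  nu *m K = (K *t 1%:M + 1%:M *t Y) *m nu ->
  kraus nu w *m K = K *m kraus nu w + kraus nu (Y *m w).
Proof.
move=> hY nuK; rewrite -kraus_mulr nuK mulmxDl krausD !kraus_tensl.
by rewrite adjmx1 hY !mul1mx.
Qed.

End Components.

(** * Construction of the antiunitary conjugation *)

Section Conjugation.
Variables (n m : nat).
Implicit Types (u w : 'cV[C]_m).
Local Notation ptr X := (\matrix_(i, j) \sum_(k < m)
  X (mxtens_index (i, k)) (mxtens_index (j, k)) : 'M[C]_n).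

(** Flattening operators into rows gives [a] from the adjoints of the components of [nu], and [b]
    from the components of [mu]. On matrix units the hypothesis says that [a] and [b] have the same
    Gram matrix, and injectivity makes the rows of [b] independent, so [gram_unitary] applies. *)
Lemma kraus_unitary (mu nu : 'M[C]_(n * m, n)) :
  (forall w, kraus mu w = 0 -> w = 0) ->
  (forall A, ptr (nu *m A *m nu^t* ) = mu^t* *m (A *t 1%:M) *m mu) ->
  exists2 U : 'M[C]_m, U \is unitarymx &
    forall w, (kraus nu w)^t* = kraus mu ((w^T *m U)^t* ).
Proof.
move=> mu_inj nu_mu.
(* Column [(i, j)] holds entry [(j, i)] of an operator; in [a] this operator is an adjoint, whence
   the conjugation and the opposite index order. *)
pose a := \matrix_(k < m, s < n * n)
  (nu (mxtens_index ((mxtens_unindex s).1, k)) (mxtens_unindex s).2)^*.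
pose b := \matrix_(k < m, s < n * n)
  mu (mxtens_index ((mxtens_unindex s).2, k)) (mxtens_unindex s).1.
have bE (v : 'rV[C]_m) i j : (v *m b) 0 (mxtens_index (i, j)) = kraus mu (v^t* ) j i.
  by rewrite !mxE; apply: eq_bigr => k _; rewrite !mxE mxtens_indexK conjCK.
have aE w i j : (w^T *m a) 0 (mxtens_index (i, j)) = ((kraus nu w)^t* ) j i.
  rewrite !mxE rmorph_sum; apply: eq_bigr => k _.
  by rewrite !mxE mxtens_indexK rmorphM /= conjCK.
have b_free : row_free b.
  apply: inj_row_free => v vb; rewrite -[v]trmxCK.
  rewrite (mu_inj (v^t* ) ) ?trmx0 ?map_mx0 //; apply/matrixP => j i.
  by rewrite -bE vb !mxE.
have [|U uU aUb] := gram_unitary b_free (A := a).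
  apply/matrixP => s t; case: (mxtens_indexP s) => i j; case: (mxtens_indexP t) => i' j'.
  have := congr1 (fun X : 'M[C]_n => X i i') (nu_mu (delta_mx j j')).
  rewrite kraus_form_delta mxE; under eq_bigr do rewrite mul_delta_mxE.
  move=> abE; rewrite !mxE; under eq_bigr do rewrite !mxE !mxtens_indexK /= conjCK.
  under [RHS]eq_bigr do rewrite !mxE !mxtens_indexK /=.
  by rewrite -abE; apply: eq_bigr => k _; rewrite !mxE.
exists U => // w; apply/matrixP => j i.
by rewrite -aE -bE aUb mulmxA.
Qed.

Lemma kraus_conjugation (nu : 'M[C]_(n * m, n)) (K E Ei : 'M[C]_n) (Y F Fi : 'M[C]_m) :
  K^t* = K -> Y^t* = Y -> E^t* = E -> F^t* = F ->
  E *m Ei = 1%:M -> F *m Fi = 1%:M -> F *m Y = Y *m F ->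
  nu *m K = (K *t 1%:M + 1%:M *t Y) *m nu ->
  nu *m E = (E *t F) *m nu ->
  (forall w, kraus nu w = 0 -> w = 0) ->
  (forall A, ptr (nu *m A *m nu^t* ) = nu^t* *m (A *t (F *m F)) *m nu) ->
  exists eps : 'cV[C]_m -> 'cV[C]_m,
    [/\ forall a u w, eps (a *: u + w) = a^* *: eps u + eps w,
        bijective eps /\ (forall u w, ((eps u)^t* *m eps w) 0 0 = (w^t* *m u) 0 0),
        forall w v, (kraus nu w)^t* = kraus nu (F *m v) <-> v = eps w,
        forall w, eps (Y *m eps w) = - (Y *m w) &
        forall w, eps (eps w) = w].
Proof.
move=> hK hY hE hF EEi FFi FY nuK nuE nu_inj trnu.
have EiE := mulmx1C EEi; have FiF := mulmx1C FFi.
have F_inj u w : F *m u = F *m w -> u = w.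
  by move=> /(congr1 (mulmx Fi)); rewrite !mulmxA FiF !mul1mx.
have kraus_inj u w : kraus nu u = kraus nu w -> u = w.
  move=> uw; apply/eqP; rewrite -subr_eq0; apply/eqP/nu_inj.
  by rewrite addrC -scaleN1r kraus_antilinear uw rmorphN1 scaleN1r addNr.
have krausF w : kraus ((1%:M *t F) *m nu) w = kraus nu (F *m w).
  by rewrite kraus_tensl mul1mx hF.
(* [(1 (x) F) nu] absorbs the factor [F *m F], and stays injective since [F] is invertible. *)
have [|A|U uU nuU] := @kraus_unitary ((1%:M *t F) *m nu) nu.
- by move=> w; rewrite krausF => /nu_inj Fw0; apply: F_inj; rewrite Fw0 mulmx0.
- rewrite trnu adjmx_mul adjmx_tens adjmx1 hF !mulmxA; congr (_ *m nu).
  by rewrite -!mulmxA !tensmx_mul !mul1mx mulmx1.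
(* Complex conjugation of the coordinates followed by the adjoint of [U], hence antiunitary. *)
pose eps (w : 'cV[C]_m) : 'cV[C]_m := (w^T *m U)^t*.
have krausV w : (kraus nu w)^t* = kraus nu (F *m eps w) by rewrite nuU krausF.
have UU := unitarymxP uU; have UU' := mulmx1C UU.
have krausE w : kraus nu w *m E = E *m kraus nu (F *m w).
  by rewrite -kraus_mulr nuE kraus_tensl hF.
(* From [V(F w) = Ei V(w) E], the adjoint of [V(F w)] is [E V(F eps w) Ei], and this conjugation
   cancels the [F] in front of [eps w]. *)
have epsF w : F *m eps (F *m w) = eps w.
  apply: kraus_inj; rewrite -krausV.
  have krausFE v : kraus nu (F *m v) = Ei *m (kraus nu v *m E).
    by rewrite krausE mulmxA EiE mul1mx.
  have hEi : Ei^t* = Ei.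
    rewrite -[LHS]mulmx1 -EEi mulmxA -[X in _ *m X *m _]hE -adjmx_mul EEi.
    by rewrite adjmx1 mul1mx.
  rewrite krausFE !adjmx_mul hE hEi krausV krausFE.
  by rewrite !mulmxA EEi mul1mx -mulmxA EEi mulmx1.
have epsK w : eps (eps w) = w.
  by apply: kraus_inj; rewrite -epsF -krausV -krausV trmxCK.
have epsY w : eps (Y *m w) = - (Y *m eps w).
  apply: F_inj; apply: kraus_inj; rewrite -krausV.
  have krausY v : kraus nu (Y *m v) = kraus nu v *m K - K *m kraus nu v.
    by rewrite (kraus_commutator _ hY nuK) addrC addKr.
  (* The sign is put in the form [a *: u + w] that [kraus_antilinear] expects. *)
  have -> : F *m - (Y *m eps w) = -1 *: (Y *m (F *m eps w)) + 0.
    by rewrite addr0 scaleN1r mulmxN !mulmxA FY.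
  have kraus0 : kraus nu 0 = 0.
    have := kraus_antilinear nu (-1) 0 0.
    by rewrite scaler0 addr0 rmorphN1 scaleN1r addNr.
  rewrite kraus_antilinear kraus0 addr0 rmorphN1 scaleN1r !krausY linearB /= map_mxB.
  by rewrite !adjmx_mul hK krausV opprB.
exists eps; split => //.
- move=> a u w; rewrite /eps linearD linearZ /= mulmxDl -scalemxAl linearD linearZ /=.
  by rewrite map_mxD map_mxZ.
- split; first by exists eps => w; exact: epsK.
  move=> u w; rewrite /eps trmxCK adjmx_mul mulmxA -(mulmxA _ U) UU mulmx1.
  by rewrite !mxE; apply: eq_bigr => k _; rewrite !mxE mulrC.
- by move=> w v; split=> [|->]; rewrite krausV // => /kraus_inj/F_inj.
- by move=> w; rewrite epsY epsK.
Qed.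

End Conjugation.

(* Sending a superoperator [A |-> X A Z] to [(\tr Z) X] kills the [mu] term
   of [M] and turns the rest of it into multiples of ['i Theta - Delta] and [1],
   whose antihermitian part involves [Theta] only. *)
Lemma hamiltonian_from_generator n p (Theta Delta : 'M[C]_n) (mu : 'M[C]_(n * p, n))
    (M : 'M[C]_n -> 'M[C]_n) :
  Theta^t* = Theta -> \tr Theta = 0 -> Delta^t* = Delta ->
  (forall k, \sum_i mu (mxtens_index (i, k)) i = 0) ->
  (forall A, M A = 'i *: (Theta *m A - A *m Theta) - (Delta *m A + A *m Delta)
                   + mu^t* *m (A *t 1%:M) *m mu) ->
  let T := \matrix_(i, j) \sum_l M (delta_mx j l) i l in
  (n%:R * 'i) *: Theta *+ 2 = T - T^t*.
Proof.
move=> hTheta trTheta hDelta trmu ME T.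
(* [Z = 1] contributes the trace [n]; the right multiplications contribute multiples of the
   identity, reduced to [\tr Delta] by [\tr Theta = 0]. *)
have -> : T = n%:R *: ('i *: Theta - Delta) - (\tr Delta)%:M.
  apply/matrixP => i j; rewrite mxE.
  have deltaL (X : 'M[C]_n) l : (X *m delta_mx j l) i l = X i j.
    by rewrite -[_ *m _]mulmx1 mul_delta_mxE mxE eqxx mulr1.
  have deltaR (X : 'M[C]_n) l : (delta_mx j l *m X) i l = (i == j)%:R * X l l.
    by rewrite -[delta_mx _ _]mul1mx mul_delta_mxE mxE.
  have addE (X X' : 'M[C]_n) a b : (X + X') a b = X a b + X' a b by rewrite mxE.
  have oppE (X : 'M[C]_n) a b : (- X) a b = - X a b by rewrite mxE.
  have scaleE c (X : 'M[C]_n) a b : (c *: X) a b = c * X a b by rewrite mxE.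
  under eq_bigr => l _.
    rewrite ME !(addE, oppE, scaleE) kraus_form_delta !deltaL !deltaR.
    rewrite (_ : _ - _ = ('i * Theta i j - Delta i j)
      + (- (i == j)%:R) * ('i * Theta l l + Delta l l)); last by ring.
    over.
  rewrite !big_split /= sumr_const card_ord -big_distrr big_split -big_distrr /=.
  rewrite -/(\tr Theta) -/(\tr Delta) trTheta mulr0 add0r exchange_big /=.
  rewrite [X in _ + X]big1 ?addr0; last first.
    by move=> k _; rewrite -big_distrr /= trmu mulr0.
  by rewrite !mxE sumr_const card_ord mulNr !mulr_natl mulrnBl mulNrn.
have trDelta : (\tr Delta)^* = \tr Delta.
  by rewrite -{2}hDelta /mxtrace rmorph_sum; apply: eq_bigr => i _; rewrite !mxE.
apply/matrixP => i j.
have hT : (Theta j i)^* = Theta i j by rewrite -[in RHS]hTheta !mxE.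
have hD : (Delta j i)^* = Delta i j by rewrite -[in RHS]hDelta !mxE.
rewrite !mxE !(rmorphB, rmorphM, rmorphMn, rmorph_nat) /= conjCi hT hD trDelta.
by rewrite [j == i]eq_sym; ring.
Qed.
End Kraus.

(** * The Hamiltonian part, the Gibbs state and minimality *)

Section Quantum.
Set Implicit Arguments.
Unset Strict Implicit.
Variable R : realType.
Local Notation C := R[i].

(** [hamiltonian_from_generator] fixes [Theta] once the factor [n] is cancelled; in dimension 0
    there is only one matrix. *)
Lemma hamiltonian_part_uniq n (M : 'M[C]_n -> 'M[C]_n) Theta1 Theta2 :
  hamiltonian_part M Theta1 -> hamiltonian_part M Theta2 -> Theta1 = Theta2.
Proof.
case: n M Theta1 Theta2 => [|n] M Theta1 Theta2.
  by move=> _ _; rewrite (flatmx0 Theta1) (flatmx0 Theta2).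
pose T := \matrix_(i, j) \sum_l M (delta_mx j l) i l.
have main Theta : hamiltonian_part M Theta -> (n.+1%:R * 'i) *: Theta *+ 2 = T - T^t*.
  case=> p [Delta [mu [[hTheta trTheta] hDelta trmu ME]]].
  have {}hTheta := hermsymmx_adj hTheta; have {}hDelta := hermsymmx_adj hDelta.
  apply: (hamiltonian_from_generator hTheta trTheta hDelta _ ME).
  by move=> k; have /matrixP/(_ k 0) := trmu; rewrite !mxE.
move=> h1 h2; have := main _ h1; rewrite -(main _ h2) -2!scaler_nat !scalerA.
by apply: scalerI; rewrite !mulf_neq0 ?pnatr_eq0 ?neq0Ci.
Qed.

Lemma cexpD (t : R) x y : cexp t (x + y) = cexp t x * cexp t y :> C.
Proof. by case: x => a b; case: y => c d; rewrite /cexp /= mulrDr expRD rmorphM. Qed.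

Lemma cexpM (s t : R) x : cexp s x * cexp t x = cexp (s + t) x :> C.
Proof. by rewrite /cexp mulrDl expRD rmorphM. Qed.

Lemma cexp_conj (t : R) x : (cexp t x)^* = cexp t x :> C.
Proof. by apply: conj_Creal; rewrite complex_real. Qed.

Lemma cexp_gt0 (t : R) x : 0 < cexp t x :> C.
Proof. by rewrite ltcR expR_gt0. Qed.

(** The constant is the square root of the inverse partition function. Positive dimension makes the
    latter a nonempty sum of positive terms, hence nonzero. *)
Lemma sqrtmx_gibbs n (K : 'M[C]_n.+1) (beta : R) : K \is hermsymmx ->
  exists2 c : C, c != 0 &
    sqrtmx (gibbs beta K) = c *: spectral_fun (cexp (- (beta / 2%:R))) K.
Proof.
move=> hK; rewrite /gibbs -rmorphN expmx_spectral_fun // mxtrace_spectral_fun.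
set Z := \sum_i _; exists (sqrtC Z^-1).
  rewrite sqrtC_eq0 invr_eq0 gt_eqF // /Z big_ord_recl ltr_pwDl ?cexp_gt0 //.
  by apply: sumr_ge0 => i _; apply/ltW/cexp_gt0.
rewrite -[sqrtmx _]/(spectral_fun sqrtC _) !spectral_fun_scale spectral_fun_comp.
apply: spectral_fun_eq => x /=.
rewrite mulrC rootCMl ?ltW ?cexp_gt0 // mulrC; congr (_ * _).
have -> : cexp (- beta) x = cexp (- (beta / 2%:R)) x ^+ 2.
  by rewrite expr2 cexpM -opprD -splitr.
by rewrite sqrCK // ltW ?cexp_gt0.
Qed.

Lemma bra_tensE n m (phi : 'cV[C]_n) l j k :
  bra_tens m phi l (mxtens_index (j, k)) = (phi j 0)^* * (l == k)%:R.
Proof.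
rewrite /bra_tens castmxE /= cast_ord_id.
have -> : cast_ord (esym (mul1n m)) l = mxtens_index (0, l) by apply: val_inj.
by rewrite tensmxE !mxE.
Qed.

Lemma sprod_bra_tens n m (nu : 'M[C]_(n * m, n)) (phi psi : 'cV[C]_n) w :
  sprod w (bra_tens m phi *m nu *m psi) = sprod (tensv phi w) (nu *m psi).
Proof.
suff E : w^t* *m bra_tens m phi = (tensv phi w)^t*.
  by rewrite /sprod -(mulmxA (bra_tens m phi)) (mulmxA (w^t* )) E.
apply/matrixP => i s; case: (mxtens_indexP s) => j k.
rewrite mxE (bigD1 k) //= big1 ?addr0.
  by rewrite bra_tensE !mxE mxtens_indexK /= eqxx mulr1 !ord1 rmorphM mulrC.
by move=> l /negPf lk; rewrite bra_tensE lk !mulr0.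
Qed.

(** If [V(w) = 0], then [w] is orthogonal to the spanning vectors of the minimality condition, and
    so to itself. *)
Lemma minimal_kraus_inj n m (nu : 'M[C]_(n * m, n)) w :
  lindblad_minimal nu -> kraus nu w = 0 -> w = 0.
Proof.
move=> hmin nuw; apply: adjmx_mul_eq0; apply/matrixP => i j; rewrite !ord1 [RHS]mxE.
have [r [c [phi [psi {2}->]]]] := hmin w.
rewrite mulmx_sumr summxE big1 // => k _; rewrite -scalemxAr mxE.
have := sprod_bra_tens nu (phi k) (psi k) w; rewrite /sprod => ->.
by rewrite kraus_tensv nuw mulmx0 mul0mx mxE mulr0.
Qed.

Lemma cexp0 x : cexp 0 x = 1 :> C.
Proof. by rewrite /cexp mul0r expR0. Qed.

Lemma spectral_fun_cexp_mulV n (A : 'M[C]_n) t :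
  spectral_fun (cexp t) A *m spectral_fun (cexp (- t)) A = 1%:M.
Proof.
rewrite spectral_fun_mul -[RHS](spectral_fun_cst1 A); apply: spectral_fun_eq => x.
by rewrite cexpM subrr cexp0.
Qed.

Lemma detailed_balance_ptrace n m (K : 'M[C]_n) (beta : R) (M : 'M[C]_n -> 'M[C]_n)
    (nu : 'M[C]_(n * m, n)) (Y : 'M[C]_m) :
  K \is hermsymmx -> Y \is hermsymmx -> purely_dissipative M ->
  detailed_balance (gibbs beta K) M -> lindblad_form M nu ->
  nu *m K = (K *t 1%:M + 1%:M *t Y) *m nu ->
  forall A, ptrace (nu *m A *m nu^t* ) =
    nu^t* *m (A *t spectral_fun (cexp (- beta)) Y) *m nu.
Proof.
case: n K M nu => [|n] K M nu hK hY hdiss [Th [hTheta db _]] hnu nuK A.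
  by rewrite [LHS]flatmx0 [RHS]flatmx0.
(* Pure dissipativity makes 0 a Hamiltonian part, so uniqueness gives [Th = 0] and [M] is its own
   dissipative part. *)
have Th0 := hamiltonian_part_uniq hTheta hdiss; subst Th.
have {}db (A' B' : 'M[C]_n.+1) : sprod_rho (gibbs beta K) (M A') B' =
    sprod_rho (gibbs beta K) A' (M B').
  by have := db A' B'; rewrite /comm !mul0mx !mulmx0 !subr0 !scaler0 !subr0.
have [c c0 sE] := sqrtmx_gibbs beta hK.
have -> : spectral_fun (cexp (- beta)) Y =
    spectral_fun (cexp (- (beta / 2%:R))) Y *m spectral_fun (cexp (- (beta / 2%:R))) Y.
  by rewrite spectral_fun_mul; apply: spectral_fun_eq => x; rewrite cexpM -opprD -splitr.
apply: ptrace_of_detailed_balance (spectral_fun_cexp_mulV K _) _ _ _.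
- by apply: spectral_fun_herm => x; exact: cexp_conj.
- by apply: spectral_fun_herm => x; exact: cexp_conj.
- apply: spectral_fun_tens_intertwine nuK; try exact: hermitian_normalmx.
  exact: cexpD.
move=> A' B'; have := db A' B'; rewrite /sprod_rho sE.
rewrite !hnu /anticomm; exact: mxtrace_scale_inj.
Qed.

End Quantum.

Theorem theorem3p16 (R : realType) (n m : nat) (K : 'M[R[i]]_n) (beta : R)
    (M : {linear 'M[R[i]]_n -> 'M[R[i]]_n})
    (nu : 'M[R[i]]_(n * m, n)) (Y : 'M[R[i]]_m)
    (hK : K \is hermsymmx) (hbeta : 0 < beta)
    (hcp : cp_generator M) (hmarkov : markov_generator M)
    (hinv : invariant_under K M) (hdiss : purely_dissipative M)
    (hdb : detailed_balance (gibbs beta K) M)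
    (hnu : lindblad_form M nu) (hmin : lindblad_minimal nu)
    (hY : Y \is hermsymmx)
    (hKY : nu *m K
           = (K *t (1%:M : 'M[R[i]]_m) + (1%:M : 'M[R[i]]_n) *t Y) *m nu) :
  (forall A : 'M[R[i]]_n,
     ptrace (nu *m A *m nu ^t* )
     = nu ^t* *m (A *t expmx (- beta%:C%C *: Y)) *m nu)
  /\
  exists eps : 'cV[R[i]]_m -> 'cV[R[i]]_m,
    [/\ unique (fun e : 'cV[R[i]]_m -> 'cV[R[i]]_m =>
          antiunitary e
          /\ forall (phi psi : 'cV[R[i]]_n) (w : 'cV[R[i]]_m),
               sprod (tensv phi w) (nu *m psi)
               = sprod (nu *m phi)
                   (tensv psi (expmx (- (beta / 2%:R)%:C%C *: Y) *m e w)))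
          eps,
        forall w : 'cV[R[i]]_m, eps (Y *m eps w) = - (Y *m w) &
        forall w : 'cV[R[i]]_m, eps (eps w) = w].
Proof.
rewrite -!rmorphN !expmx_spectral_fun //.
have trnu := detailed_balance_ptrace hK hY hdiss hdb hnu hKY.
split=> //.
set F := spectral_fun (cexp (- (beta / 2%:R))) Y.
have nY := hermitian_normalmx hY; have nK := hermitian_normalmx hK.
have FFi := spectral_fun_cexp_mulV Y (- (beta / 2%:R)); rewrite -/F in FFi.
have F_herm : F^t* = F by apply: spectral_fun_herm => x; exact: cexp_conj.
have FF : F *m F = spectral_fun (cexp (- beta)) Y.
  by rewrite spectral_fun_mul; apply: spectral_fun_eq => x; rewrite cexpM -opprD -splitr.
have [||||eps [eps_lin [eps_bij eps_iso] eps_kraus epsY epsK]] :=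
  kraus_conjugation (hermsymmx_adj hK) (hermsymmx_adj hY) _ F_herm
    (spectral_fun_cexp_mulV K (- (beta / 2%:R))) FFi _ hKY _
    (fun w => minimal_kraus_inj hmin).
- by apply: spectral_fun_herm => x; exact: cexp_conj.
- by symmetry; apply: spectral_fun_intertwine.
- by apply: spectral_fun_tens_intertwine => //; exact: cexpD.
- by move=> A; rewrite FF -trnu.
exists eps; split => //; split.
  split; first by split.
  have krausV w : (kraus nu w)^t* = kraus nu (F *m eps w) by apply/eps_kraus.
  by move=> phi psi w; rewrite /sprod kraus_tensv kraus_adj_tensv -krausV trmxCK.
(* The relation for a competitor [e], read through matrix elements, says [V(w)^* = V(F (e w))]; by
   [eps_kraus] this forces [e w = eps w]. *)
move=> e [_ he]; apply/funext => w.
symmetry; apply/eps_kraus; rewrite -[RHS]trmxCK; congr (_^t* ).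
by apply: form_inj => phi psi; rewrite -kraus_tensv -kraus_adj_tensv; exact: he.
Qed.
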